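(* Let $n\ge4$ and let $F(a_i,b_i)$ be a real closed 2-frieze pattern of width $n-4$. All the entries of the pattern (in the rows between the two rows of $1$'s) are positive if and only if the corresponding $n$-gon in $\mathbb R^3$ is convex.
   Context: Indices $(p,q)$ of a 2-frieze range over pairs in $\mathbb Z^2\cup(\mathbb Z+\tfrac12)^2$ with $p-q\ge -3$; the entries with $p-q=r$ form row $r$. A 2-frieze pattern satisfies the rule $$v_{p,q}=v_{p-\frac12,q-\frac12}\,v_{p+\frac12,q+\frac12}-v_{p-\frac12,q+\frac12}\,v_{p+\frac12,q-\frac12}$$ for all $(p,q)$ with $p-q\ge -2$. The algebraic 2-frieze $F(A_i,B_i)$, with $A_i,B_i$ ($i\in\mathbb Z$) independent formal variables, is the 2-frieze in which rows $-3$ and $-2$ consist of $0$'s, row $-1$ consists of $1$'s, $v_{i,i}=A_i$ and $v_{i-\frac12,i-\frac12}=B_i$ (row $0$), and the rows $r\ge1$ are determined by the rule in the field of rational functions; all its entries are polynomials in the $A_i,B_i$. The numerical 2-frieze $F(a_i,b_i)$ is the evaluation at $A_i=a_i$, $B_i=b_i$. It is closed of width $n-4$ if row $n-4$ consists of $1$'s and rows $n-3,n-2$ consist of $0$'s; then $a_{i+n}=a_i$, $b_{i+n}=b_i$. The rows between the two rows of $1$'s are rows $0,\dots,n-5$. Corresponding $n$-gon: the difference equation $V_i=a_iV_{i-1}-b_iV_{i-2}+V_{i-3}$ associated with a closed 2-frieze of width $n-4$ has only $n$-periodic solutions; the corresponding $n$-gon is a solution $(V_i)$ with $V_i\in\mathbb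 R^3$, $\det(V_{i-1},V_i,V_{i+1})=1$ for all $i$ and $V_{i+n}=V_i$; it is unique up to the action of $\mathrm{SL}_3(\mathbb R)$. The $n$-gon $(V_1,\dots,V_n)$ in $\mathbb R^3$ is convex if, for each $i$, $\det(V_{i-1},V_i,V_j)>0$ for all $j\ne i-1,i$ (indices modulo $n$). *)

(* Defs.v *)
From HB Require Import structures.
From mathcomp Require Import all_boot all_order all_algebra.
From mathcomp Require Import finmap.
From mathcomp.multinomials Require Import monalg.
From mathcomp Require Import boolp classical_sets reals.

Set Implicit Arguments.
Unset Strict Implicit.
Unset Printing Implicit Defensive.

Import Order.TTheory GRing.Theory Num.Theory.
Local Open Scope ring_scope.

Section MonomialEvaluation.
Context (I : choiceType) (S : comNzRingType) (x : I -> S).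

Definition cmeval (m : {cmonom I}) : S := \prod_(i <- finsupp m) x i ^+ m i.

Lemma cmevalEw (s : seq I) (m : {cmonom I}) :
  uniq s -> {subset finsupp m <= s} -> cmeval m = \prod_(i <- s) x i ^+ m i.
Proof.
move=> us sub; rewrite /cmeval.
rewrite [RHS](bigID (fun i => i \in finsupp m)) /= [X in _ * X]big1 ?mulr1.
  rewrite -[RHS]big_filter; apply/perm_big/uniq_perm; rewrite ?filter_uniq //.
  by move=> i; rewrite mem_filter; case: (boolP (i \in _)) => //= /sub ->.
by move=> i; rewrite -cmE_eq0 => /eqP ->.
Qed.

Fact cmeval_mmorphism : mmorphism cmeval.
Proof.
split=> [m1 m2|]; last by rewrite /cmeval mdom1 big_seq_fset0.
have us : uniq (finsupp (mmul m1 m2)) by exact: fset_uniq.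
rewrite !(cmevalEw us) // -?big_split /=.
- by apply: eq_bigr => i _; rewrite cmM exprD.
- by move=> i im; rewrite mdomD in_fsetE im orbT.
- by move=> i im; rewrite mdomD in_fsetE im.
Qed.

HB.instance Definition _ :=
  monalg.isMultiplicative.Build {cmonom I} S cmeval cmeval_mmorphism.

End MonomialEvaluation.

(* Polynomials with integer coefficients in a possibly infinite family of
   variables indexed by I. *)
Definition zpoly (I : choiceType) := {malg int[{cmonom I}]}.

HB.instance Definition _ (I : choiceType) := GRing.ComNzRing.on (zpoly I).

Definition zvar (I : choiceType) (i : I) : zpoly I := mkmalgU (ucm i) 1.

Definition zeval (I : choiceType) (S : comNzRingType) (x : I -> S)
  (P : zpoly I) : S := mmap (intr : int -> S) (cmeval x) P.

HB.instance Definition _ (I : choiceType) (S : comNzRingType) (x : I -> S) :=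
  GRing.RMorphism.copy (zeval x) (mmap (intr : int -> S) (cmeval x)).

Section ZPolyIntegral.
Context (I : choiceType).

(* Kronecker substitution of powers of one variable, used to see that zpoly I
   is an integral domain. *)
Definition kron (D : nat) (s : seq I) (i : I) : {poly int} :=
  'X ^+ (D ^ index i s).

Definition kronw (D : nat) (s : seq I) (m : I -> nat) : nat :=
  \sum_(i <- s) m i * D ^ index i s.

Lemma kronw_inj D s (m1 m2 : I -> nat) : uniq s ->
  {in s, forall i, (m1 i < D)%N} -> {in s, forall i, (m2 i < D)%N} ->
  kronw D s m1 = kronw D s m2 -> {in s, m1 =1 m2}.
Proof.
elim: s => // j s IHs /= /andP[js us] lt1 lt2.
have rec m : kronw D (j :: s) m = (kronw D s m * D + m j)%N.
  rewrite /kronw big_cons /= eqxx expn0 muln1 addnC; congr addn.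
  rewrite big_distrl /= big_seq [RHS]big_seq; apply: eq_bigr => i si.
  by case: eqP => [ji|_]; [rewrite ji si in js | rewrite expnS -mulnA [(D * _)%N]mulnC].
have l1 := lt1 j (mem_head _ _); have l2 := lt2 j (mem_head _ _).
have D0 : (0 < D)%N by apply: leq_trans l1.
rewrite !rec => eqk.
have eqj : m1 j = m2 j.
  by rewrite -(modn_small l1) -(modn_small l2) -(modnMDl (kronw D s m1)) eqk modnMDl.
have eqs : kronw D s m1 = kronw D s m2.
  by move: eqk; rewrite eqj => /addIn/eqP; rewrite eqn_pmul2r // => /eqP.
move=> i; rewrite inE => /predU1P[-> //|si]; apply: IHs eqs i si => // k sk.
  by apply: lt1; rewrite inE sk orbT.
by apply: lt2; rewrite inE sk orbT.
Qed.

Lemma cmeval_kron D s (m : {cmonom I}) : uniq s -> {subset finsupp m <= s} ->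
  cmeval (kron D s) m = 'X ^+ kronw D s m.
Proof.
move=> us sub; rewrite (cmevalEw _ us sub) /kronw.
elim/big_rec2: _ => [|i n P _ ->]; first by rewrite expr0.
by rewrite exprD mulnC exprM.
Qed.

Lemma zeval_kron_neq0 D s (P : zpoly I) : uniq s ->
  {in msupp P, forall m : {cmonom I}, {subset finsupp m <= s}} ->
  {in msupp P, forall (m : {cmonom I}) i, (m i < D)%N} ->
  P != 0 -> zeval (kron D s) P != 0.
Proof.
move=> us sub lt P0.
have intC (z : int) : (z%:~R : {poly int}) = z%:P.
  by rewrite -[in RHS](intz z) rmorph_int.
have [m mP] : exists m, m \in msupp P.
  by apply/fset0Pn; rewrite msupp_eq0.
apply/eqP => /(congr1 (fun Q : {poly int} => Q`_(kronw D s m))).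
rewrite coef0 /zeval mmapE coef_sum (big_fsetD1 m) //= big1_seq.
  rewrite addr0 cmeval_kron //; last exact: sub.
  rewrite intC coefCM coefXn eqxx mulr1 => /eqP.
  by rewrite mcoeff_eq0 mP.
move=> k /andP[_]; rewrite in_fsetD1 => /andP[km kP].
rewrite cmeval_kron //; last exact: sub.
rewrite intC coefCM coefXn; case: eqP; rewrite ?mulr0 // => eqw.
case/negP: km; apply/cmP => i.
have [si|] := boolP (i \in s).
  by apply: (kronw_inj us _ _ (esym eqw)) si => j _; apply: lt.
move=> si.
have out (n : {cmonom I}) : n \in msupp P -> n i = 0%N.
  by move=> nP; apply/eqP; rewrite cmE_eq0; apply: contra si; exact: sub.
by rewrite !out.
Qed.

Fact zpoly_integral (P Q : zpoly I) : P * Q = 0 -> (P == 0) || (Q == 0).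
Proof.
move=> PQ0; apply/norP => -[P0 Q0].
pose L : seq {cmonom I} := msupp P ++ msupp Q.
pose s := undup (flatten (map (fun m : {cmonom I} => finsupp m : seq I) L)).
pose D := (\max_(m <- L) mdeg m).+1.
have sub (m : {cmonom I}) : m \in L -> {subset finsupp m <= s}.
  move=> mL i im; rewrite mem_undup; apply/flattenP.
  by exists (finsupp m : seq I) => //; apply/mapP; exists m.
have lt (m : {cmonom I}) i : m \in L -> (m i < D)%N.
  move=> mL; rewrite ltnS; apply: leq_trans (leq_bigmax_seq _ mL isT).
  have [im|] := boolP (i \in finsupp m); last by rewrite -cmE_eq0 => /eqP ->.
  by rewrite mdegE (big_fsetD1 i) //= leq_addr.
have us : uniq s by exact: undup_uniq.
have kP : zeval (kron D s) P != 0.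
  by apply: zeval_kron_neq0 => // m mP; [apply: sub|move=> i; apply: lt];
     rewrite mem_cat mP.
have kQ : zeval (kron D s) Q != 0.
  by apply: zeval_kron_neq0 => // m mQ; [apply: sub|move=> i; apply: lt];
     rewrite mem_cat mQ orbT.
by have := mulf_neq0 kP kQ; rewrite -rmorphM PQ0 rmorph0 eqxx.
Qed.

Definition zpoly_unit : pred (zpoly I) := fun P => `[< exists Q, Q * P = 1 >].

Definition zpoly_inv (P : zpoly I) : zpoly I :=
  if pselect (exists Q, Q * P = 1) is left invP then sval (cid invP) else P.

Fact zpoly_mulVr : {in zpoly_unit, left_inverse 1 zpoly_inv *%R}.
Proof.
move=> P uP; rewrite /zpoly_inv; case: pselect => [uP'|nuP].
  by case: (cid uP').
by case: nuP; apply/asboolP.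
Qed.

Fact zpoly_unitPl (P Q : zpoly I) : Q * P = 1 -> zpoly_unit P.
Proof. by move=> QP; apply/asboolP; exists Q. Qed.

Fact zpoly_invr_out : {in [predC zpoly_unit], zpoly_inv =1 id}.
Proof.
move=> P nuP; rewrite /zpoly_inv; case: pselect => // uP.
by case/negP: nuP; apply/asboolP.
Qed.

HB.instance Definition _ := GRing.ComNzRing_hasMulInverse.Build (zpoly I)
  zpoly_mulVr zpoly_unitPl zpoly_invr_out.

HB.instance Definition _ :=
  GRing.ComUnitRing_isIntegral.Build (zpoly I) zpoly_integral.

End ZPolyIntegral.

(* Since p, q are both integers or both half-integers exactly when
   r = p - q and s = p + q are integers (p = (s + r)/2, q = (s - r)/2, and any
   r, s occur), an array indexed by these pairs is a function v of (r, s), the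
   entry v_{p,q} being v (p - q) (p + q), in row p - q.  The shifts
   (p -+ 1/2, q -+ 1/2) and (p -+ 1/2, q +- 1/2) become s -+ 1 and r -+ 1, so
   that the rule reads
     v r s = v r (s - 1) * v r (s + 1) - v (r - 1) s * v (r + 1) s.
   Only the rows r >= -3 are meaningful. *)
Definition entries (T : Type) := int -> int -> T.

(* v_{i,i} = A i is at s = 2i and v_{i-1/2,i-1/2} = B i is at s = 2i - 1. *)
Definition zeroth_row (T : Type) (A B : int -> T) (s : int) : T :=
  if (2 %| s)%Z then A (s %/ 2)%Z else B ((s + 1) %/ 2)%Z.

(* inl i stands for A_i and inr i for B_i; the fraction field is
   Q(A_i, B_i : i in Z). *)
Definition polAB := zpoly (int + int)%type.
Definition ratAB := {fraction polAB}.
Definition varA (i : int) : polAB := zvar (inl i).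
Definition varB (i : int) : polAB := zvar (inr i).

(* Rows k - 1 and k; the second component of the successor case is the rule
   centred at row k solved for its entry in row k + 1. *)
Fixpoint alg_rows (k : nat) : (int -> ratAB) * (int -> ratAB) :=
  if k is k'.+1 then
    let: (u, w) := alg_rows k' in
    (w, fun s => (w (s - 1) * w (s + 1) - w s) / u s)
  else (fun=> 1, zeroth_row (fun i => FracField.tofrac (varA i))
                            (fun i => FracField.tofrac (varB i))).

Definition alg_2frieze : entries ratAB := fun r s =>
  match r with
  | Posz k => (alg_rows k).2 s
  | Negz 0 => 1
  | Negz _ => 0
  end.

(* The polynomial equal to the rational function x (unique as polAB embeds in
   ratAB); the default value only serves when x is not a polynomial, which is
   the case of no entry of alg_2frieze. *)
Definition polynomial_of (x : ratAB) : polAB :=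
  xget 0 [set P : polAB | FracField.tofrac P = x]%classic.

Section NumericalFrieze.
Context (R : realType).
Implicit Types (a b : int -> R) (V : int -> 'rV[R]_3).

Definition evalAB a b : polAB -> R :=
  zeval (fun x : int + int => match x with inl i => a i | inr i => b i end).

Definition num_2frieze a b : entries R :=
  fun r s => evalAB a b (polynomial_of (alg_2frieze r s)).

Definition closed_2frieze (n : nat) a b : Prop :=
  forall s : int,
    [/\ num_2frieze a b (n%:Z - 4) s = 1,
        num_2frieze a b (n%:Z - 3) s = 0 &
        num_2frieze a b (n%:Z - 2) s = 0].

Definition positive_2frieze (n : nat) a b : Prop :=
  forall r s : int, 0 <= r -> r <= n%:Z - 5 -> 0 < num_2frieze a b r s.

Definition det3 (u v w : 'rV[R]_3) : R :=
  \det (\matrix_(k < 3) nth 0 [:: u; v; w] k).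

Definition corresponding_ngon (n : nat) a b V : Prop :=
  [/\ forall i, V i = a i *: V (i - 1) - b i *: V (i - 2) + V (i - 3),
      forall i, det3 (V (i - 1)) (V i) (V (i + 1)) = 1 &
      forall i, V (i + n%:Z) = V i].

(* The n-gon is given by its n-periodic sequence of vertices, so that indices
   modulo n are integers compared modulo n. *)
Definition convex_ngon (n : nat) V : Prop :=
  forall i j : int, (j != i - 1 %[mod n%:Z])%Z -> (j != i %[mod n%:Z])%Z ->
    0 < det3 (V (i - 1)) (V i) (V j).

End NumericalFrieze.

(* Main.v *)
Require Import Defs.
From mathcomp Require Import all_boot all_order all_algebra reals.
From mathcomp Require Import finmap.
From mathcomp.multinomials Require Import monalg.
From mathcomp Require Import boolp classical_sets.
From mathcomp Require Import ring lra zify.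

(** Every entry of the frieze is a 3 x 3 determinant of vertices of the polygon,
two of which are consecutive: for integers p, q,
<<
  v_{p,q} = det (V_{q-3}, V_{q-2}, V_p),
  v_{p-1/2,q-1/2} = det (V_{p-1}, V_p, V_{q-3}).
>>
Once this is known ([num_2frieze_frieze_of]), the theorem compares two lists of
determinants.  Up to the n-periodicity of V, the determinants
det (V_{i-1}, V_i, V_j) with j different from i - 1 and i modulo n are those
with j = i + 1 and j = i - 2, which equal 1 because three consecutive vertices
have determinant 1, and those with i + 2 <= j <= i + n - 3, which are exactly
the entries with integer indices of the rows 0, ..., n - 5; the entries with
half-integer indices of these rows are determinants of the same kind.

The determinantal formula rests on the fact that, for any solution of
V_i = a_i V_{i-1} - b_i V_{i-2} + V_{i-3} with unit determinants, the array of
determinants satisfies the 2-frieze rule: this is a three-term Pluecker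
relation in which one factor is the determinant of three consecutive vertices
([frieze_of_rule]).  Its rows -1 and 0 are those of the frieze.

The entries of the numerical frieze, however, are obtained by evaluating the
algebraic one, and cannot be computed by the rule, which would divide by
entries that may vanish.  So the formula is first proved for a solution U with
coordinates in the ring of polynomials in the A_i and B_i, where the division is
legitimate because no entry is the zero polynomial: at A_i = B_i = 3 the frieze
is the array of triangular numbers ([frieze_of_all3]).  Evaluating U at
(a_i, b_i) gives some solution of the numerical equation, perhaps not V; but
the determinants of the first kind, as functions of p, solve the equation with
initial values 0, 0, 1, and those of the second kind are polynomials in them by
the rule, so the array does not depend on the solution ([frieze_of_unique]). *)

Set Implicit Arguments.
Unset Strict Implicit.
Unset Printing Implicit Defensive.

Import Order.TTheory GRing.Theory Num.Theory.
Local Open Scope ring_scope.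

(** * Determinants of three vectors over a commutative ring *)

Section Volume.
Context (S : comNzRingType).
Implicit Types u v w x y : 'rV[S]_3.

(** The determinant, in expanded form so that identities between determinants
become ring identities. *)
Definition vol u v w : S :=
  u 0 0 * (v 0 1 * w 0 2 - v 0 2 * w 0 1)
  - u 0 1 * (v 0 0 * w 0 2 - v 0 2 * w 0 0)
  + u 0 2 * (v 0 0 * w 0 1 - v 0 1 * w 0 0).

Lemma vol_cycle u v w : vol v w u = vol u v w.
Proof. by rewrite /vol; ring. Qed.

Lemma vol_swap u v w : vol u w v = - vol u v w.
Proof. by rewrite /vol; ring. Qed.

Lemma vol_combr u v w x y (c d : S) :
  vol u v (c *: w - d *: x + y) = c * vol u v w - d * vol u v x + vol u v y.
Proof. by rewrite /vol !mxE; ring. Qed.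

Lemma volvv u v : vol u v v = 0.
Proof. by rewrite /vol; ring. Qed.

Lemma volvwv u v : vol u v u = 0.
Proof. by rewrite /vol; ring. Qed.

(** The Pluecker relation in the plane of 3-space modulo v. *)
Lemma vol_plucker u v w x y :
  vol u v x * vol v w y - vol u v y * vol v w x = vol u v w * vol x y v.
Proof. by rewrite /vol; ring. Qed.

End Volume.

Lemma det3E (R : realType) (u v w : 'rV[R]_3) : det3 u v w = vol u v w.
Proof.
rewrite /det3 (expand_det_row _ 0) !big_ord_recl big_ord0 /cofactor.
rewrite !(expand_det_row _ 0) !big_ord_recl !big_ord0 /cofactor !det_mx11 !mxE /=.
(* The expansion produces each index under many names; naming coordinates by
   natural numbers identifies them. *)
have [c cE] : exists c, forall (x : 'rV[R]_3) (i : 'I_3), x 0 i = c x (val i).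
  by exists (fun x k => x 0 (inord k)) => x i; rewrite inord_val.
by rewrite /vol !cE /= /bump /=; ring.
Qed.

(** * The difference equation *)

Lemma two_sided_iteration (T : Type) (f g : int -> T -> T) (t0 : T) :
  (forall i, cancel (g i) (f i)) ->
  exists t : int -> T, t 0 = t0 /\ forall i, t (i + 1) = f i (t i).
Proof.
move=> gK.
pose fwd := fix fwd k := if k is k'.+1 then f k'%:Z (fwd k') else t0.
pose bwd := fix bwd k := if k is k'.+1 then g (Negz k') (bwd k') else t0.
exists (fun i => match i with Posz k => fwd k | Negz k => bwd k.+1 end).
split=> // -[k|k]; first by rewrite -PoszD addn1.
case: k => [|k]; first by rewrite gK.
by rewrite (_ : Negz k.+1 + 1 = Negz k) ?gK //; lia.
Qed.

Section Solutions.
Context (S : comNzRingType).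
Implicit Types (A B : int -> S) (V : int -> 'rV[S]_3).

Definition unimodular_solution A B V :=
  (forall i, V i = A i *: V (i - 1) - B i *: V (i - 2) + V (i - 3)) /\
  (forall i, vol (V (i - 1)) (V i) (V (i + 1)) = 1).

(** The equation can be run in both directions since the coefficient of V_{i-3}
is 1, and that coefficient is also why the determinant of three consecutive
vectors is constant; start from the standard basis. *)
Lemma unimodular_solution_exists A B : exists V, unimodular_solution A B V.
Proof.
(* The state at i is the triple (V_{i-2}, V_{i-1}, V_i). *)
pose f i (t : 'rV[S]_3 * 'rV[S]_3 * 'rV[S]_3) :=
  (t.1.2, t.2, A (i + 1) *: t.2 - B (i + 1) *: t.1.2 + t.1.1).
pose g i (t : 'rV[S]_3 * 'rV[S]_3 * 'rV[S]_3) :=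
  (t.2 - A (i + 1) *: t.1.2 + B (i + 1) *: t.1.1, t.1.1, t.1.2).
have gK i : cancel (g i) (f i).
  move=> [[x y] z]; rewrite /f /g /=; congr (_, _).
  by apply/rowP => k; rewrite !mxE; ring.
have [t [t0 tS]] := two_sided_iteration (delta_mx 0 0, delta_mx 0 1, delta_mx 0 2) gK.
have t1 i : (t (i + 1)).1.2 = (t i).2 by rewrite tS.
have t2 i : (t (i + 1)).1.1 = (t i).1.2 by rewrite tS.
have t1' i : (t i).1.2 = (t (i - 1)).2 by rewrite -t1 subrK.
have t2' i : (t i).1.1 = (t (i - 2)).2.
  by rewrite -[i in LHS](subrK 1) t2 t1'; congr (t _).2; ring.
have volS i : vol (t (i + 1)).1.1 (t (i + 1)).1.2 (t (i + 1)).2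
            = vol (t i).1.1 (t i).1.2 (t i).2.
  by rewrite tS /f /= vol_combr volvv volvwv !mulr0 subr0 add0r vol_cycle.
have vol1 i : vol (t i).1.1 (t i).1.2 (t i).2 = 1.
  elim/int_ind: i => [|k IH|k IH].
  - by rewrite t0 /vol !mxE /=; ring.
  - by rewrite -[(k.+1)%:Z]/(1 + k%:Z) addrC volS.
  - by rewrite -[LHS]volS -[RHS]IH; congr (vol (t _).1.1 (t _).1.2 (t _).2); lia.
exists (fun i => (t i).2); split=> i.
  rewrite -[i in LHS](subrK 1) tS /f /= subrK t1' t2'.
  by congr (_ - _ *: (t _).2 + (t _).2); ring.
by rewrite -(vol1 (i + 1)) t1 t2 t1'.
Qed.

End Solutions.

(** * The 2-frieze of determinants of a solution *)

Section Frieze.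
Context (S : comNzRingType).
Implicit Types (A B : int -> S) (V : int -> 'rV[S]_3).

(** The entry (r, s) has indices p = (s + r) / 2 and q' = (s - r) / 2.  When q'
is an integer, q = q'; when it is a half-integer, q = q' + 1/2, so that the
entry is v_{p-1/2,q-1/2} with p = q + r. *)
Definition frieze_of V : entries S := fun r s =>
  let q := ((s - r + 1) %/ 2)%Z in
  if (2 %| s - r)%Z then vol (V (q - 3)) (V (q - 2)) (V (q + r))
  else vol (V (q + r - 1)) (V (q + r)) (V (q - 3)).

Lemma frieze_of_integer V r s q : s = q *+ 2 + r ->
  frieze_of V r s = vol (V (q - 3)) (V (q - 2)) (V (q + r)).
Proof.
move=> ->; rewrite /frieze_of ifT; last lia.
by rewrite (_ : ((_ + _) %/ 2)%Z = q); last lia.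
Qed.

Lemma frieze_of_half V r s q : s = q *+ 2 - 1 + r ->
  frieze_of V r s = vol (V (q + r - 1)) (V (q + r)) (V (q - 3)).
Proof.
move=> ->; rewrite /frieze_of ifF; last lia.
by rewrite (_ : ((_ + _) %/ 2)%Z = q); last lia.
Qed.

Lemma unimodular_vol A B V : unimodular_solution A B V ->
  forall i j k, j = i + 1 -> k = i + 2 -> vol (V i) (V j) (V k) = 1.
Proof.
move=> [_ vol1] i j k -> ->; rewrite -[RHS](vol1 (i + 1)).
by congr (vol (V _) (V _) (V _)); lia.
Qed.

Lemma entry_parity (r s : int) :
  exists q, s = q *+ 2 + r \/ s = q *+ 2 - 1 + r.
Proof. by exists ((s - r + 1) %/ 2)%Z; lia. Qed.

(** With five vertices a, b, c, x, y of which a, b, c are consecutive, the rule is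
[vol_plucker]: around an entry with integer indices a, b, c are
V_{p-1}, V_p, V_{p+1}, and around an entry with half-integer indices they are
V_{q-4}, V_{q-3}, V_{q-2}. *)
Lemma frieze_of_rule A B V r s : unimodular_solution A B V ->
  frieze_of V r s =
  frieze_of V r (s - 1) * frieze_of V r (s + 1)
  - frieze_of V (r - 1) s * frieze_of V (r + 1) s.
Proof.
move=> /unimodular_vol vol1; have [q [sE|sE]] := entry_parity r s.
- rewrite (frieze_of_integer V sE) (@frieze_of_half V r (s - 1) q); last lia.
  rewrite (@frieze_of_half V r (s + 1) (q + 1)); last lia.
  rewrite (@frieze_of_half V (r - 1) s (q + 1)); last lia.
  rewrite (@frieze_of_half V (r + 1) s q); last lia.
  have := vol_plucker (V (q + r - 1)) (V (q + r)) (V (q + r + 1)) (V (q - 3)) (V (q - 2)).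
  rewrite (vol1 _ _ (q + r + 1)) ?mul1r => [<-||]; try lia.
  by congr (vol (V _) (V _) (V _) * vol (V _) (V _) (V _) -
    vol (V _) (V _) (V _) * vol (V _) (V _) (V _)); lia.
- rewrite (frieze_of_half V sE) (@frieze_of_integer V r (s - 1) (q - 1)); last lia.
  rewrite (@frieze_of_integer V r (s + 1) q); last lia.
  rewrite (@frieze_of_integer V (r - 1) s q); last lia.
  rewrite (@frieze_of_integer V (r + 1) s (q - 1)); last lia.
  rewrite [X in _ = _ - X]mulrC.
  have := vol_plucker (V (q - 4)) (V (q - 3)) (V (q - 2)) (V (q + r - 1)) (V (q + r)).
  rewrite (vol1 (q - 4) (q - 3) (q - 2)) ?mul1r => [<-||]; try lia.
  by congr (vol (V _) (V _) (V _) * vol (V _) (V _) (V _) -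
    vol (V _) (V _) (V _) * vol (V _) (V _) (V _)); lia.
Qed.

Lemma frieze_of_row_m1 A B V s :
  unimodular_solution A B V -> frieze_of V (-1) s = 1.
Proof.
move=> /unimodular_vol vol1; have [q [sE|sE]] := entry_parity (-1) s.
  by rewrite (frieze_of_integer V sE) vol1 //; lia.
by rewrite (frieze_of_half V sE) vol_cycle vol1 //; lia.
Qed.

(** Substituting the equation for V_q in the determinant leaves a single term,
the one in V_{q-1} for an integer entry and the one in V_{q-2} for a
half-integer entry. *)
Lemma frieze_of_row0 A B V s :
  unimodular_solution A B V -> frieze_of V 0 s = zeroth_row A B s.
Proof.
move=> VAB; have [rec _] := VAB; have vol1 := unimodular_vol VAB.
rewrite /zeroth_row; have [q [sE|sE]] := entry_parity 0 s.
  rewrite (frieze_of_integer V sE) ifT; last lia.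
  rewrite (_ : (s %/ 2)%Z = q); last lia.
  rewrite addr0 [V q]rec vol_combr volvv volvwv mulr0 subr0 addr0.
  by rewrite vol1 ?mulr1 //; lia.
rewrite (frieze_of_half V sE) ifF; last lia.
rewrite (_ : ((s + 1) %/ 2)%Z = q); last lia.
rewrite addr0 vol_cycle [V q]rec vol_combr volvwv volvv vol_swap.
by rewrite vol1 ?mulr0 ?sub0r ?mulrN1 ?opprK ?addr0 //; lia.
Qed.

(** As a function of p, the determinant solves the scalar difference equation with
initial values 0, 0, 1 at q - 3, q - 2, q - 1. *)
Lemma vol_unique A B V V' (q p : int) :
  unimodular_solution A B V -> unimodular_solution A B V' -> q - 3 <= p ->
  vol (V (q - 3)) (V (q - 2)) (V p) = vol (V' (q - 3)) (V' (q - 2)) (V' p).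
Proof.
move=> VAB VAB' qp; have [[rec _] [rec' _]] := (VAB, VAB').
have [k pE] : exists k : nat, p = q - 3 + k%:Z by exists (absz (p - (q - 3))%R); lia.
elim/ltn_ind: k p pE {qp} => -[_|[_|[_|k IH]]] p pE.
- by rewrite (_ : p = q - 3) ?volvwv //; lia.
- by rewrite (_ : p = q - 2) ?volvv //; lia.
- by rewrite (unimodular_vol VAB) ?(unimodular_vol VAB') //; lia.
rewrite (rec p) (rec' p) !vol_combr.
by congr (_ * _ - _ * _ + _); [apply: (IH k.+2)|apply: (IH k.+1)|apply: (IH k)]; lia.
Qed.

(** The rule centred at a half-integer entry expresses it through four entries
with integer indices, to which [vol_unique] applies. *)
Lemma frieze_of_unique A B V V' (k : nat) s :
  unimodular_solution A B V -> unimodular_solution A B V' ->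
  frieze_of V k%:Z s = frieze_of V' k%:Z s.
Proof.
move=> hV hV'.
have integer r s' q : -3 <= r -> s' = q *+ 2 + r ->
    frieze_of V r s' = frieze_of V' r s'.
  move=> r3 sE; rewrite !(frieze_of_integer _ sE).
  by apply: vol_unique hV hV' _; lia.
have [q [sE|sE]] := entry_parity k s; first by apply: integer sE; lia.
rewrite (frieze_of_rule _ _ hV) (frieze_of_rule _ _ hV').
by congr (_ * _ - _ * _);
  [apply: (integer _ _ (q - 1))|apply: (integer _ _ q)|
   apply: (integer _ _ q)|apply: (integer _ _ (q - 1))]; lia.
Qed.

End Frieze.

(** * Change of coefficients *)

Section Transport.
Context (S S' : comNzRingType) (phi : {rmorphism S -> S'}).
Implicit Types (A B : int -> S) (V : int -> 'rV[S]_3).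

Lemma vol_map u v w :
  vol (map_mx phi u) (map_mx phi v) (map_mx phi w) = phi (vol u v w).
Proof. by rewrite /vol !mxE !(rmorphD, rmorphB, rmorphN, rmorphM). Qed.

Lemma unimodular_solution_map A B V : unimodular_solution A B V ->
  unimodular_solution (phi \o A) (phi \o B) (fun i => map_mx phi (V i)).
Proof.
move=> [rec vol1]; split=> i; last by rewrite vol_map vol1 rmorph1.
by rewrite [in LHS]rec map_mxD map_mxB !map_mxZ.
Qed.

Lemma frieze_of_map V r s :
  frieze_of (fun i => map_mx phi (V i)) r s = phi (frieze_of V r s).
Proof. by rewrite /frieze_of; case: ifP => _; rewrite vol_map. Qed.

End Transport.

Lemma zeval_zvar (I : choiceType) (S : comNzRingType) (x : I -> S) i :
  zeval x (zvar i) = x i.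
Proof.
by rewrite /zeval mmapU /= mulr1z mul1r /cmeval mdomU big_seq_fset1 cmUU expr1.
Qed.

(** * The algebraic and the numerical 2-frieze *)

(** For A_i = B_i = 3 the equation says that third differences vanish, and V is a
parametrized parabola.  The entries are then constant along rows, hence
determined by v_r ^ 2 - v_{r-1} v_{r+1} = v_r. *)
Lemma frieze_of_all3 (V : int -> 'rV[rat]_3) :
  unimodular_solution (fun=> 3) (fun=> 3) V ->
  forall (k : nat) s, frieze_of V k%:Z s = (k%:R + 2) * (k%:R + 3) / 2.
Proof.
move=> hV.
suff claim (k : nat) : (forall s, frieze_of V (k%:Z - 1) s = (k%:R + 1) * (k%:R + 2) / 2)
    /\ (forall s, frieze_of V k%:Z s = (k%:R + 2) * (k%:R + 3) / 2).
  by move=> k s; have [_] := claim k.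
elim: k => [|k [IHu IHw]].
  split=> s; first by rewrite (frieze_of_row_m1 _ hV).
  by rewrite (frieze_of_row0 _ hV) /zeroth_row; case: ifP.
rewrite -addn1 PoszD addrK natrD.
split=> s; first by rewrite IHw; congr (_ * _ / _); ring.
have k0 : 0 <= k%:R :> rat by exact: ler0n.
have := frieze_of_rule k%:Z s hV; rewrite !IHw IHu => E.
have /mulfI : (k%:R + 1) * (k%:R + 2) / 2 != 0 :> rat.
  by rewrite gt_eqF // !mulr_gt0 ?invr_gt0 ?ltr_wpDl.
by apply; lra.
Qed.

(** This is what makes the divisions in the definition of the algebraic frieze
meaningful. *)
Lemma frieze_of_neq0 (U : int -> 'rV[polAB]_3) (k : nat) s :
  unimodular_solution varA varB U -> frieze_of U k%:Z s != 0.
Proof.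
move=> hU; pose three : int + int -> rat := fun=> 3.
apply/eqP => /(congr1 (zeval three)); rewrite rmorph0 -frieze_of_map.
rewrite frieze_of_all3.
  apply/eqP; rewrite gt_eqF //.
  by rewrite !mulr_gt0 ?invr_gt0 ?ltr_wpDl.
have := unimodular_solution_map (zeval three) hU.
by congr unimodular_solution; apply/funext => i /=; rewrite zeval_zvar.
Qed.

Lemma alg_rows_frieze_of (U : int -> 'rV[polAB]_3) (k : nat) :
  unimodular_solution varA varB U -> forall s,
  (alg_rows k).1 s = FracField.tofrac (frieze_of U (k%:Z - 1) s) /\
  (alg_rows k).2 s = FracField.tofrac (frieze_of U k%:Z s).
Proof.
move=> hU; elim: k => [|k IH] s /=.
  rewrite sub0r (frieze_of_row_m1 _ hU) (frieze_of_row0 _ hU).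
  split; first by apply: esym; exact: tofrac1.
  by rewrite /zeroth_row; case: ifP.
have IH1 t := (IH t).1; have IH2 t := (IH t).2.
case: (alg_rows k) {IH} IH1 IH2 => u w /= IH1 IH2.
rewrite -addn1 PoszD addrK; split; first exact: IH2.
have u0 : FracField.tofrac (frieze_of U (k%:Z - 1) s) != 0.
  rewrite tofrac_eq0; case: k {IH1 IH2} => [|k].
    by rewrite (frieze_of_row_m1 _ hU) oner_eq0.
  by rewrite -addn1 PoszD addrK frieze_of_neq0.
rewrite IH1 !IH2 -rmorphM -rmorphB [frieze_of U k%:Z s](frieze_of_rule _ _ hU).
by rewrite opprB addrC subrK rmorphM mulrC mulKf.
Qed.

(** The numerical frieze is determinantal for every solution: the formula holds
for a generic U, hence after evaluation for the image of U, and then for V by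
[frieze_of_unique]. *)
Lemma num_2frieze_frieze_of (R : realType) (a b : int -> R) V (k : nat) s :
  unimodular_solution a b V -> num_2frieze a b k%:Z s = frieze_of V k%:Z s.
Proof.
move=> hV; have [U hU] := unimodular_solution_exists varA varB.
rewrite /num_2frieze /= (alg_rows_frieze_of k hU s).2 /polynomial_of.
rewrite (@xget_unique _ _ _ (frieze_of U k%:Z s)) //; last first.
  by move=> P /eqP; rewrite tofrac_eq => /eqP.
rewrite /evalAB -frieze_of_map; apply: frieze_of_unique hV.
have := unimodular_solution_map
  (zeval (fun x : int + int => match x with inl i => a i | inr i => b i end)) hU.
by congr unimodular_solution; apply/funext => i /=; rewrite zeval_zvar.
Qed.

(** * Positivity and convexity *)

Lemma periodic_mod (T : Type) (f : int -> T) (n : nat) i j :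
  (forall k, f (k + n%:Z) = f k) -> (i = j %[mod n%:Z])%Z -> f i = f j.
Proof.
move=> per; suff fm (k : int) : f k = f (k %% n%:Z)%Z by rewrite fm => ->; rewrite -fm.
rewrite [k in LHS](divz_eq k n%:Z); elim/int_ind: (k %/ n%:Z)%Z => [|q IH|q IH].
- by rewrite mul0r add0r.
- by rewrite -IH -[RHS]per; congr f; lia.
- by rewrite -IH -[LHS]per; congr f; lia.
Qed.

Lemma small_diff_neq_mod (n : nat) (i j : int) :
  0 < i - j -> i - j < n%:Z -> (i != j %[mod n%:Z])%Z.
Proof.
move=> d0 dn; rewrite eqz_mod_dvd; apply/negP => /dvdz_mod0P.
by rewrite modz_small; lia.
Qed.

Theorem proposition2p6 (R : realType) (n : nat) (hn : (4 <= n)%N)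
  (a b : int -> R) (hclosed : closed_2frieze n a b)
  (V : int -> 'rV[R]_3) (hV : corresponding_ngon n a b V) :
  positive_2frieze n a b <-> convex_ngon n V.
Proof.
have [rec det1 per] := hV.
have VAB : unimodular_solution a b V.
  by split=> // i; rewrite -det3E.
have vol1 := unimodular_vol VAB.
split=> [pos i j|conv r s r0 rn].
- move=> ji1 ji; rewrite det3E.
  pose k := ((j - i) %% n%:Z)%Z.
  have jE : (j = i + k %[mod n%:Z])%Z by rewrite /k modzDmr addrC subrK.
  have k_ge0 : 0 <= k by apply: modz_ge0; lia.
  have k_lt : k < n%:Z by apply: ltz_pmod; lia.
  clearbody k.
  have k0 : k != 0.
    by apply: contra ji => /eqP k0; rewrite jE k0 addr0.
  have kn1 : k != n%:Z - 1.
    apply: contra ji1 => /eqP kn1; rewrite jE kn1.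
    by rewrite addrCA modzDl.
  rewrite (periodic_mod per jE).
  (* Now 1 <= k <= n - 2, and at both ends the vertices are consecutive. *)
  have [k1|k1] := eqVneq k 1; first by rewrite vol1 //; lia.
  have [k2|k2] := eqVneq k (n%:Z - 2).
    have -> : i + k = (i - 2) + n%:Z by lia.
    by rewrite per vol_cycle vol1 //; lia.
  have [m mE] : exists m : nat, k - 2 = m%:Z by exists (absz (k - 2)%R); lia.
  have -> : vol (V (i - 1)) (V i) (V (i + k))
      = frieze_of V m%:Z ((i + 2) *+ 2 + m%:Z).
    by rewrite (frieze_of_integer _ (erefl _)); congr (vol (V _) (V _) (V _)); lia.
  by rewrite -(num_2frieze_frieze_of _ _ VAB); apply: pos; lia.
- have [m rE] : exists m : nat, r = m%:Z by exists (absz r); lia.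
  rewrite rE (num_2frieze_frieze_of _ _ VAB) -rE.
  have [q [sE|sE]] := entry_parity r s.
    have -> : frieze_of V r s = vol (V (q - 2 - 1)) (V (q - 2)) (V (q + r)).
      by rewrite (frieze_of_integer _ sE); congr (vol (V _) (V _) (V _)); lia.
    rewrite -det3E; apply: conv.
      by apply: small_diff_neq_mod; lia.
    by apply: small_diff_neq_mod; lia.
  rewrite (frieze_of_half _ sE) -det3E.
  by apply: conv; rewrite eq_sym; apply: small_diff_neq_mod; lia.
Qed.
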